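(* For any $n\geq 1$, the map $\Gamma$ is a bijection from the set of cell-wings of dimension $n-1$ of $\mathsf{CC}(n)$ to the set $\mathsf{SCC}(n)$ of synchronized cubic coordinates of size $n$.
   Context: For integers $i,j$, $[i,j]=\{i,i+1,\dots,j\}$ and $[i]=[1,i]$. A Tamari diagram of size $n$ is a word $u$ of length $n$ on $\mathbb{N}=\{0,1,2,\dots\}$ such that $0\leq u_i\leq n-i$ for all $i\in[n]$ and $u_{i+j}\leq u_i-j$ for all $i\in[n]$, $j\in[0,u_i]$. A dual Tamari diagram of size $n$ is a word $v$ of length $n$ on $\mathbb{N}$ such that $0\leq v_i\leq i-1$ for all $i\in[n]$ and $v_{i-j}\leq v_i-j$ for all $i\in[n]$, $j\in[0,v_i]$. They are compatible if there are no $1\leq i<j\leq n$ with $u_i\geq j-i$ and $v_j\geq j-i$. A Tamari interval diagram of size $n$ is a pair $(u,v)$ of compatible Tamari and dual Tamari diagrams of size $n$. A cubic coordinate of size $n$ is an $(n-1)$-tuple of integers of the form $(u_1-v_2,\dots,u_{n-1}-v_n)$ with $(u,v)$ a Tamari interval diagram of size $n$; $\mathsf{CC}(n)$ is the set of these, ordered by $c\preccurlyeq c'$ iff $c_i\leq c'_i$ for all $i\in[n-1]$. A cubic coordinate $c$ is synchronized if $c_i\neq 0$ for all $i\in[n-1]$; $\mathsf{SCC}(n)$ is the set of these. For $c\in\mathsf{CC}(n)$ and $i\in[n-1]$, $\uparrow_i(c)$ denotes the element of $\mathsf{CC}(n)$ that covers $c$ and differs from $c$ only at index $i$, when such an element exists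 (it is then unique). By convention $\uparrow_n(c)=c$. An output-wing is an element $c\in\mathsf{CC}(n)$ covered by exactly $n-1$ elements (equivalently, $\uparrow_i(c)$ exists for all $i\in[n-1]$). For an output-wing $c$, its corresponding input-wing is $\uparrow_1(\uparrow_2(\cdots(\uparrow_{n-1}(\uparrow_n(c)))\cdots))$, which is a well-defined cubic coordinate. For $c\preccurlyeq c'$ in $\mathsf{CC}(n)$, the cell $\langle c,c'\rangle$ is $\{x\in\mathbb{R}^{n-1}: c_i\leq x_i\leq c'_i \text{ for all } i\in[n-1]\}$, and its dimension is the number of indices $d$ with $c_d\neq c'_d$. A cell-wing is a cell $\langle c^{\mathrm{out}},c^{\mathrm{in}}\rangle$ where $c^{\mathrm{out}}$ is an output-wing and $c^{\mathrm{in}}$ is its corresponding input-wing. For a cell-wing $\langle c^{\mathrm{out}},c^{\mathrm{in}}\rangle$ of dimension $n-1$, $\Gamma\langle c^{\mathrm{out}},c^{\mathrm{in}}\rangle$ is the $(n-1)$-tuple whose $i$-th component is $c^{\mathrm{out}}_i$ if $c^{\mathrm{out}}_i<0$ and $c^{\mathrm{in}}_i$ if $c^{\mathrm{out}}_i\geq 0$, for all $i\in[n-1]$. *)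

(* Defs.v *)
From HB Require Import structures.
From mathcomp Require Import all_boot all_order all_algebra.
From mathcomp Require Import all_classical reals.

Set Implicit Arguments.
Unset Strict Implicit.
Unset Printing Implicit Defensive.

Import Order.TTheory GRing.Theory Num.Theory.

Local Open Scope classical_set_scope.
Local Open Scope card_scope.
Local Open Scope ring_scope.

(* Letters and components are indexed from 0: the letter u_i of a word of
   size n, for i in [n], is [nth 0 u (i - 1)], and the component c_i of an
   (n-1)-tuple is [tnth c (i - 1)].  All the truncated subtractions below are exact
   under the hypotheses that guard them. *)

Definition is_tamari (n : nat) (u : n.-tuple nat) : Prop :=
  (forall i : nat, i < n -> nth 0 u i <= n - i.+1)%N /\
  (forall i j : nat, i < n -> j <= nth 0 u i ->
     nth 0 u (i + j) <= nth 0 u i - j)%N.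

Definition is_dual_tamari (n : nat) (v : n.-tuple nat) : Prop :=
  (forall i : nat, i < n -> nth 0 v i <= i)%N /\
  (forall i j : nat, i < n -> j <= nth 0 v i ->
     nth 0 v (i - j) <= nth 0 v i - j)%N.

Definition compatible (n : nat) (u v : n.-tuple nat) : Prop :=
  ~ exists i j : nat,
      [/\ (i < j < n)%N, (j - i <= nth 0 u i)%N & (j - i <= nth 0 v j)%N].

Definition is_tamari_interval_diagram (n : nat) (u v : n.-tuple nat) : Prop :=
  [/\ is_tamari u, is_dual_tamari v & compatible u v].

Definition CC (n : nat) : set (n.-1.-tuple int) :=
  [set c | exists u v : n.-tuple nat, is_tamari_interval_diagram u v /\
     forall i : 'I_n.-1,
       tnth c i = (nth 0%N u i)%:Z - (nth 0%N v i.+1)%:Z].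
Arguments CC n : clear implicits.

Definition SCC (n : nat) : set (n.-1.-tuple int) :=
  [set c | CC n c /\ forall i : 'I_n.-1, tnth c i != 0].
Arguments SCC n : clear implicits.

Definition cc_le (n : nat) (c c' : n.-1.-tuple int) : Prop :=
  forall i : 'I_n.-1, tnth c i <= tnth c' i.

Definition cc_lt (n : nat) (c c' : n.-1.-tuple int) : Prop :=
  cc_le c c' /\ c <> c'.

(* [cc_covers c c']: the element c' covers c in the poset CC n. *)
Definition cc_covers (n : nat) (c c' : n.-1.-tuple int) : Prop :=
  [/\ CC n c, CC n c', cc_lt c c' &
      ~ exists d, [/\ CC n d, cc_lt c d & cc_lt d c']].

(* The upward move at one index; it takes the junk value c when no cover of c
   differs from c only at index i. *)
Definition up (n : nat) (i : 'I_n.-1) (c : n.-1.-tuple int) :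
    n.-1.-tuple int :=
  xget c [set c' | cc_covers c c' /\
                   forall j : 'I_n.-1, j != i -> tnth c' j = tnth c j].

Definition output_wing (n : nat) (c : n.-1.-tuple int) : Prop :=
  CC n c /\ [set c' | cc_covers c c'] #= `I_n.-1.

(* The upward moves are performed from the last index to the first one. *)
Definition input_wing (n : nat) (c : n.-1.-tuple int) : n.-1.-tuple int :=
  foldr (@up n) c (enum 'I_n.-1).

Definition cell (R : realType) (n : nat) (c c' : n.-1.-tuple int) :
    set 'rV[R]_n.-1 :=
  [set x : 'rV[R]_n.-1 | forall i : 'I_n.-1,
     (tnth c i)%:~R <= x ord0 i <= (tnth c' i)%:~R].
Arguments cell R {n} c c' _ : rename.

(* Cells are genuine subsets of R^(n-1); [corners X] recovers the pair
   (c, c') from X = <c, c'>, see [corners_cell].  Its value is junk when X is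
   not a cell. *)
Definition corners (R : realType) (n : nat) (X : set 'rV[R]_n.-1) :
    n.-1.-tuple int * n.-1.-tuple int :=
  xget (nseq_tuple n.-1 0, nseq_tuple n.-1 0)
    [set p | [/\ CC n p.1, CC n p.2, cc_le p.1 p.2 & X = cell R p.1 p.2]].

Lemma cell_inj (R : realType) (n : nat) (c c' d d' : n.-1.-tuple int) :
  cc_le c c' -> cc_le d d' -> cell R c c' = cell R d d' -> c = d /\ c' = d'.
Proof.
move=> cc' dd' E.
have sub (a a' b b' : n.-1.-tuple int) : cc_le a a' ->
    cell R a a' = cell R b b' -> cc_le b a /\ cc_le a' b'.
  move=> aa' Eab.
  have h1 : cell R a a' (\row_i (tnth a i)%:~R).
    by move=> i; rewrite mxE lexx ler_int aa'.
  have h2 : cell R a a' (\row_i (tnth a' i)%:~R).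
    by move=> i; rewrite mxE lexx ler_int aa'.
  rewrite Eab in h1 h2; split=> i.
    by have := h1 i; rewrite mxE !ler_int => /andP[].
  by have := h2 i; rewrite mxE !ler_int => /andP[].
have [h1 h2] := sub _ _ _ _ cc' E.
have [h3 h4] := sub _ _ _ _ dd' (esym E).
by split; apply: eq_from_tnth => i; apply/le_anti/andP.
Qed.

Lemma corners_cell (R : realType) (n : nat) (c c' : n.-1.-tuple int) :
  CC n c -> CC n c' -> cc_le c c' -> corners (cell R c c') = (c, c').
Proof.
move=> Cc Cc' cc'; apply: xget_unique => //= -[d d'] [/= _ _ dd' E].
by have [-> ->] := cell_inj cc' dd' E.
Qed.

Definition cell_dim (R : realType) (n : nat) (X : set 'rV[R]_n.-1) : nat :=
  #|[pred i : 'I_n.-1 | tnth (corners X).1 i != tnth (corners X).2 i]|.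

Definition cell_wing (R : realType) (n : nat) (X : set 'rV[R]_n.-1) : Prop :=
  exists2 c, output_wing c & X = cell R c (input_wing c).

Definition Gamma (R : realType) (n : nat) (X : set 'rV[R]_n.-1) :
    n.-1.-tuple int :=
  let: (cout, cin) := corners X in
  [tuple if tnth cout i < 0 then tnth cout i else tnth cin i | i < n.-1].

(* Main.v *)
Require Import Defs.
From HB Require Import structures.
From mathcomp Require Import all_boot all_order all_algebra zify.
From mathcomp Require Import all_classical reals.

Set Implicit Arguments.
Unset Strict Implicit.
Unset Printing Implicit Defensive.

Import Order.TTheory GRing.Theory Num.Theory.

Local Open Scope classical_set_scope.
Local Open Scope card_scope.
Local Open Scope ring_scope.

(** Number the letters of the words u and v by 0, ..., n-1 and read them as
arms: u_i as the interval from i to its right end i + u_i, and v_j as the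
interval from j - v_j to j. The Tamari conditions say that the right arms form
a nested family, and so do the left arms; compatibility says that no right arm
reaches a position whose left arm reaches back to its origin. A component c_i
encodes the right arm of i if c_i >= 0 and the left arm of i+1 if c_i <= 0, and
raising it means lengthening the former or shortening the latter.

The key point is that each upward move is explicit. At a negative component it
is always possible, since the left arm can be shortened to length 0, and the
new component is at most 0. At a nonnegative component, let m be the position
just after the right end of i. By nesting, the least possible new right end of
i is the right end of m, and the move exists iff m is a position, the left arm
of m stops short of i, and no right arm started before i ends where that of i
ends ([raise_jumpable], [jumpable_raisable]). Elements that cover c differ from
it at one component only ([cc_le_step]), so an output-wing is a c with all n-1
moves available ([output_wingP]).

Let c be an output-wing and d its input-wing. The moves are performed from the
last index down, so position m has already its final right end when i is
treated. Hence, writing r and r' for the right ends in c and d, r' i = r' (r i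
+ 1) if c_i >= 0 and c_i < d_i <= 0 if c_i < 0 ([input_wing_raised]). In
particular all components increase, and Gamma produces the coordinate with the
right arms of d and the left arms of c, which has no zero component. It is a
cubic coordinate by following the jumps i -> r i + 1 ([fill_CC]).

Conversely, r can be recovered from r': the right arms of d starting strictly
inside the arm of i in c do not leave it ([reach_raised_inner]), so r i + 1 is
the first position k > i with r' k >= r' i. This proves injectivity
([fill_inj]). Applying the same recipe to a synchronized s defines a coordinate
[hollow s]; it is an output-wing, and the recursion for r' rebuilds s from it
([fill_hollow]). *)

(** * Cubic coordinates as nested arms *)

(** The right end of i, and the length of the left arm of j. No component
carries the right arm of the last position or the left arm of position 0: the
default value 0 of [nth] and the second branch of [back] give them length 0. *)
Definition reach (c : seq int) (i : nat) : nat := (i + `|(Num.max c`_i 0)%R|)%N.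

Definition back (c : seq int) (j : nat) : nat :=
  if j is i.+1 then `|(Num.max (- c`_i) 0)%R|%N else 0%N.

(** The conditions on a Tamari interval diagram in terms of the ends of its
arms. The left end j - back c j is kept on the other side of each inequality,
so that no truncated subtraction occurs. *)
Record cubic (n : nat) (c : seq int) : Prop := Cubic {
  reach_lt : forall i, (i < n)%N -> (reach c i < n)%N;
  reach_closed : forall i k, (i <= k)%N -> (k <= reach c i)%N ->
    (i < n)%N -> (reach c k <= reach c i)%N;
  back_le : forall j, (j < n)%N -> (back c j <= j)%N;
  back_closed : forall j k, (k <= j)%N -> (j <= k + back c j)%N ->
    (j < n)%N -> (j + back c k <= k + back c j)%N;
  reach_back : forall i j, (i < j)%N -> (j < n)%N -> (j <= reach c i)%N ->
    (i + back c j < j)%N }.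

(** A coordinate determines its diagram: compatibility of i and i+1 prevents
u_i and v_(i+1) from being both positive, so they are the positive and negative
parts of their difference. *)
Lemma CC_cubic (n : nat) (c : n.-1.-tuple int) : (0 < n)%N ->
  CC n c <-> cubic n c.
Proof.
move=> n_gt0.
have szc : size c = n.-1 by rewrite size_tuple.
split=> [[u [v [[[u1 u2] [v1 v2] uv] cE]]]|[c1 c2 c3 c4 c5]].
  have cN i : (i < n.-1)%N -> c`_i = (nth 0%N u i)%:Z - (nth 0%N v i.+1)%:Z.
    by move=> lti; rewrite -(cE (Ordinal lti)) (tnth_nth 0).
  have adj i : (i < n.-1)%N -> nth 0%N u i = 0%N \/ nth 0%N v i.+1 = 0%N.
    move=> lti; case: (posnP (nth 0%N u i)) => [|ui]; first by left.
    case: (posnP (nth 0%N v i.+1)) => [|vi]; first by right.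
    by case: uv; exists i, i.+1; split; lia.
  have rE i : (i < n)%N -> reach c i = (i + nth 0 u i)%N.
    move=> ltin; rewrite /reach; have [lti|lei] := ltnP i n.-1.
      by rewrite cN //; have := adj i lti; lia.
    by rewrite nth_default ?szc //; have := u1 i ltin; lia.
  have bE j : (j < n)%N -> back c j = nth 0%N v j.
    case: j => [|j] ltj /=; first by have := v1 0%N ltj; lia.
    have ltj' : (j < n.-1)%N by lia.
    by rewrite cN //; have := adj j ltj'; lia.
  split.
  - by move=> i lti; rewrite rE //; have := u1 i lti; lia.
  - move=> i k ik + lti; rewrite rE // => ki.
    have := u1 i lti; have := u2 i (k - i)%N lti; rewrite subnKC // => h1 h2.
    by rewrite rE; lia.
  - by move=> j ltj; rewrite bE //; exact: v1.
  - move=> j k kj + ltj; rewrite bE // => jk.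
    by have := v2 j (j - k)%N ltj; rewrite subKn // bE; lia.
  - move=> i j ij ltj; rewrite rE ?bE //; last lia.
    move=> ji; rewrite ltnNge; apply/negP => le; apply: uv.
    by exists i, j; split; lia.
exists [tuple (reach c i - i)%N | i < n], [tuple back c i | i < n].
have uE i : (i < n)%N ->
    nth 0%N [tuple (reach c i - i)%N | i < n] i = (reach c i - i)%N.
  by move=> lti; rewrite -(tnth_nth 0%N _ (Ordinal lti)) tnth_mktuple.
have vE i : (i < n)%N -> nth 0%N [tuple back c i | i < n] i = back c i.
  by move=> lti; rewrite -(tnth_nth 0%N _ (Ordinal lti)) tnth_mktuple.
have ge i : (i <= reach c i)%N by rewrite leq_addr.
split; last first.
  by move=> [i lti] /=; rewrite (tnth_nth 0) /= uE ?vE /reach /=; lia.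
split; first split.
- by move=> i lti; rewrite uE //; have := c1 i lti; lia.
- move=> i j lti; rewrite uE // => le; have := c1 i lti => h.
  by rewrite uE; [have := c2 i (i + j)%N; have := ge i|]; lia.
- split=> [i lti|i j lti]; rewrite vE //; first exact: c3.
  move=> le; rewrite vE; last lia.
  by have := c4 i (i - j)%N; have := c3 i lti; lia.
- move=> [i [j [ijn]]]; rewrite uE ?vE; [|lia..].
  by have := c5 i j; have := ge i; lia.
Qed.

(** * Changing one component *)

Definition agree_off (i : nat) (c d : seq int) : Prop :=
  forall k, k != i -> d`_k = c`_k.

Lemma reach_ge (c : seq int) (i : nat) : (i <= reach c i)%N.
Proof. exact: leq_addr. Qed.

Lemma reach_agree i (c d : seq int) k :
  agree_off i c d -> k != i -> reach d k = reach c k.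
Proof. by move=> cd ki; rewrite /reach cd. Qed.

Lemma back_agree i (c d : seq int) j :
  agree_off i c d -> j != i.+1 -> back d j = back c j.
Proof. by move=> cd; case: j => //= j ji; rewrite cd. Qed.

(** Shortening a left arm can break neither the compatibility nor the arms that
enclose it; only the left arms based inside the shortened one can now stick out
of it. *)
Lemma shrink_back n (c d : seq int) i : cubic n c -> (i.+1 < n)%N ->
  agree_off i c d -> c`_i < d`_i -> d`_i <= 0 ->
  (forall k, (k <= i)%N -> (i < k + back d i.+1)%N ->
     (i.+1 + back c k <= k + back d i.+1)%N) ->
  cubic n d.
Proof.
move=> [c1 c2 c3 c4 c5] lti cd cdi di0 clos.
have rE k : reach d k = reach c k.
  by have [->|/(reach_agree cd)//] := eqVneq k i; rewrite /reach; lia.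
have bE j : j != i.+1 -> back d j = back c j by exact: back_agree cd.
have bi : (back d i.+1 < back c i.+1)%N by rewrite /back; lia.
split.
- by move=> k; rewrite rE; exact: c1.
- by move=> k l; rewrite !rE; exact: c2.
- move=> j ltj; have [->|/bE->] := eqVneq j i.+1; last exact: c3.
  by have := c3 i.+1 lti; lia.
- move=> j k; have [->|kNi] := eqVneq k i.+1; have [->//|jNi] := eqVneq j i.+1.
  + by rewrite (bE j) // => kj h ltj; have := c4 _ _ kj h ltj; lia.
  + by rewrite (bE k) // => ki h _; apply: clos; lia.
  + by rewrite !bE //; exact: c4.
- move=> k j; rewrite rE => kj ltj h; have := c5 _ _ kj ltj h.
  by have [->|/bE->//] := eqVneq j i.+1; lia.
Qed.

(** Lengthening a right arm may break the nesting on both sides and the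
compatibility, hence the three conditions. *)
Lemma extend_reach n (c d : seq int) i : cubic n c -> (i < n)%N ->
  agree_off i c d -> 0 <= c`_i -> c`_i < d`_i -> (reach d i < n)%N ->
  (forall k, (i < k)%N -> (k <= reach d i)%N -> (reach c k <= reach d i)%N) ->
  (forall k, (k < i)%N -> (i <= reach c k)%N -> (reach d i <= reach c k)%N) ->
  (forall j, (i < j)%N -> (j <= reach d i)%N -> (i + back c j < j)%N) ->
  cubic n d.
Proof.
move=> [c1 c2 c3 c4 c5] lti cd ci0 cdi rlt inner outer cross.
have bE j : back d j = back c j.
  have [->|/(back_agree cd)//] := eqVneq j i.+1; rewrite /back; lia.
have rE k : k != i -> reach d k = reach c k by exact: reach_agree cd.
split.
- by move=> k ltk; have [->//|/rE->] := eqVneq k i; exact: c1.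
- move=> k l; have [->|kNi] := eqVneq k i; have [->//|lNi] := eqVneq l i.
  + by rewrite (rE l) // => il h _; apply: inner; lia.
  + by rewrite (rE k) // => ki h _; apply: outer; lia.
  + by rewrite !rE //; exact: c2.
- by move=> j; rewrite bE; exact: c3.
- by move=> j k; rewrite !bE; exact: c4.
- move=> k j; rewrite bE; have [->|/rE->] := eqVneq k i; last exact: c5.
  by move=> ij _; exact: cross.
Qed.

Definition upd n (c : n.-1.-tuple int) (i : 'I_n.-1) (x : int) :
    n.-1.-tuple int :=
  [tuple if j == i then x else tnth c j | j < n.-1].

Lemma upd_at n (c : n.-1.-tuple int) i x : (upd c i x)`_i = x.
Proof. by rewrite -tnth_nth tnth_mktuple eqxx. Qed.

Lemma upd_agree n (c : n.-1.-tuple int) (i : 'I_n.-1) x :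
  agree_off i c (upd c i x).
Proof.
move=> k kNi; have [ltk|lek] := ltnP k n.-1; last first.
  by rewrite !nth_default ?size_tuple.
by rewrite -!(tnth_nth 0 _ (Ordinal ltk)) tnth_mktuple -val_eqE /= (negPf kNi).
Qed.

Lemma cc_leP n (c d : n.-1.-tuple int) :
  cc_le c d <-> forall k, c`_k <= d`_k.
Proof.
split=> [cd k|cd i]; last by rewrite !(tnth_nth 0) cd.
have [ltk|lek] := ltnP k n.-1; last by rewrite !nth_default ?size_tuple.
by have := cd (Ordinal ltk); rewrite !(tnth_nth 0).
Qed.

Lemma eq_nth_tuple n (c d : n.-1.-tuple int) : (forall k, c`_k = d`_k) -> c = d.
Proof. by move=> cd; apply: eq_from_tnth => i; rewrite !(tnth_nth 0). Qed.

Lemma agree_off_le n (i : nat) (c d : n.-1.-tuple int) :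
  agree_off i c d -> c`_i <= d`_i -> cc_le c d.
Proof.
by move=> cd le; apply/cc_leP => k; have [->//|/cd->] := eqVneq k i.
Qed.

Lemma reach_le (c d : seq int) i : c`_i <= d`_i -> (reach c i <= reach d i)%N.
Proof. by rewrite /reach; lia. Qed.

Lemma lt_reach (c d : seq int) i : (reach c i < reach d i)%N -> c`_i < d`_i.
Proof. by rewrite /reach; lia. Qed.

Lemma back_ge (c d : seq int) j :
  (forall k, c`_k <= d`_k) -> (back d j <= back c j)%N.
Proof. by case: j => //= j /(_ j); lia. Qed.

(** Between two comparable coordinates one can climb by changing a single
component, so that covers change one component only. The left arms are treated
before the right arms: shortening them preserves compatibility, and once all of
them agree with those of d, the right arms can grow towards those of d, which
are compatible with them. In both phases the index treated is the least one at
stake: the nesting with the arms of smaller index is then inherited from d, and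
that with the arms of larger index follows from monotonicity. *)
Lemma cc_le_step n (c d : n.-1.-tuple int) : (0 < n)%N ->
  CC n c -> CC n d -> cc_lt c d ->
  exists i e, [/\ CC n e, agree_off (i : 'I_n.-1) c e, c`_i < e`_i & cc_le e d].
Proof.
move=> n_gt0 /(CC_cubic _ n_gt0) cc /(CC_cubic _ n_gt0) dd [/cc_leP cd cNd].
have least (P : pred 'I_n.-1) : (exists i, P i) ->
    exists2 i, P i & forall k : 'I_n.-1, (k < i)%N -> ~~ P k.
  case=> i0 Pi0; case: (@arg_minnP _ i0 P val Pi0) => i Pi mini.
  by exists i => // k ki; apply/negP => /mini; rewrite leqNgt ki.
pose diff (i : 'I_n.-1) := c`_i < d`_i.
have szE k : (n.-1 <= k)%N -> c`_k = 0 /\ d`_k = 0.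
  by move=> lek; rewrite !nth_default ?size_tuple.
case: (pselect (exists i, diff i && (c`_i < 0))) => [/least|nodiff].
  move=> [i /andP[di ci0] mini].
  (* d_i may be positive, but only the left arm is adjusted in this phase *)
  pose e := upd c i (Num.min d`_i 0).
  have eN : agree_off i c e by exact: upd_agree.
  have ei : e`_i = Num.min d`_i 0 := upd_at _ _ _.
  have ltin : (i.+1 < n)%N by have := ltn_ord i; lia.
  exists i, e; split; [|by []|by rewrite ei; move: di; rewrite /diff; lia|].
    apply/(CC_cubic _ n_gt0); move: di; rewrite /diff => di.
    apply: (shrink_back cc ltin eN); rewrite ?ei; [lia..|].
    have -> : back e i.+1 = back d i.+1 by rewrite /back ei; lia.
    move=> k ki h.
    have -> : back c k = back d k; last by apply: (back_closed dd); lia.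
    case: k ki {h} => // k ki.
    have ltk : (k < n.-1)%N by have := ltn_ord i; lia.
    have := mini (Ordinal ltk) ki; have := cd k; rewrite /diff /back /=; lia.
  apply/cc_leP => k; have [->|/eN->//] := eqVneq k i; rewrite ei; lia.
have cge k : c`_k < d`_k -> 0 <= c`_k.
  move=> ck; rewrite leNgt; apply/negP => ck0; apply: nodiff.
  have ltk : (k < n.-1)%N by rewrite ltnNge; apply/negP => /szE[]; lia.
  by exists (Ordinal ltk); apply/andP.
have [i di mini] :
    exists2 i, diff i & forall k : 'I_n.-1, (k < i)%N -> ~~ diff k.
  apply/least/not_existsP => nod; apply: cNd; apply: eq_nth_tuple => k.
  have [ltk|/szE[->->]//] := ltnP k n.-1.
  by have := nod (Ordinal ltk); have := cd k; rewrite /diff /back /=; lia.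
pose e := upd c i d`_i.
have eN : agree_off i c e by exact: upd_agree.
have ei : e`_i = d`_i := upd_at _ _ _.
have ltin : (i.+1 < n)%N by have := ltn_ord i; lia.
have rei : reach e i = reach d i by rewrite /reach ei.
have ci0 := cge i di.
exists i, e; split; [|by []|by rewrite ei|]; last first.
  by apply/cc_leP => k; have [->|/eN->//] := eqVneq k i; rewrite ei.
apply/(CC_cubic _ n_gt0).
apply: (extend_reach cc (ltnW ltin) eN); rewrite ?ei ?rei //.
- exact: (reach_lt dd (ltnW ltin)).
- move=> k ik ki; apply: leq_trans (reach_le (cd k)) _.
  exact: (reach_closed dd (ltnW ik) ki (ltnW ltin)).
- move=> k ki; have ltk : (k < n.-1)%N by have := ltn_ord i; lia.
  have -> : reach c k = reach d k.
    have := mini (Ordinal ltk) ki; have := cd k.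
    by rewrite /diff /reach /=; lia.
  by move=> ik; apply: (reach_closed dd (ltnW ki) ik); lia.
- move=> j ij ji; have ltj := leq_ltn_trans ji (reach_lt dd (ltnW ltin)).
  have := reach_back dd ij ltj ji.
  case: j {ij ji ltj} => // j; rewrite /back; have := cge j; have := cd j; lia.
Qed.

(** * Upward moves and output-wings *)

Definition raisable n (c : n.-1.-tuple int) (i : 'I_n.-1) : Prop :=
  exists d : n.-1.-tuple int, [/\ CC n d, agree_off i c d & c`_i < d`_i].

Lemma agree_offP n (c d : n.-1.-tuple int) (i : 'I_n.-1) :
  agree_off i c d <-> forall j, j != i -> tnth d j = tnth c j.
Proof.
split=> [cd j ji|cd k ki]; first by rewrite !(tnth_nth 0) cd.
have [ltk|lek] := ltnP k n.-1; last by rewrite !nth_default ?size_tuple.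
by have := cd (Ordinal ltk) ki; rewrite !(tnth_nth 0).
Qed.

Lemma cc_lt_agree n (c d : n.-1.-tuple int) (i : nat) :
  agree_off i c d -> c`_i < d`_i -> cc_lt c d.
Proof.
move=> cd lti; split; first exact: agree_off_le cd (ltW lti).
by move=> E; rewrite E ltxx in lti.
Qed.

(** On the line through c in direction i the order is total and discrete, so a
least element above c exists; it covers c because everything between them lies
on the same line. *)
Lemma up_raisable n (c : n.-1.-tuple int) i : CC n c -> raisable c i ->
  [/\ cc_covers c (up i c), agree_off i c (up i c), c`_i < (up i c)`_i &
      forall d : n.-1.-tuple int, CC n d -> agree_off i c d -> c`_i < d`_i ->
        (up i c)`_i <= d`_i].
Proof.
move=> cc [d0 [d0C cd0 ltd0]].
have lineE (d : n.-1.-tuple int) (t : nat) : agree_off i c d ->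
    d`_i = c`_i + t.+1%:Z -> d = upd c i (c`_i + t.+1%:Z).
  move=> cd dE; apply: eq_nth_tuple => k; have [->|ki] := eqVneq k (i : nat).
    by rewrite upd_at.
  by rewrite upd_agree ?cd.
have exP : exists t, `[< CC n (upd c i (c`_i + t.+1%:Z)) >].
  exists `|(d0`_i - c`_i)%R|%N.-1; apply/asboolP.
  rewrite -(@lineE d0 _ cd0) //; lia.
have [t /asboolP tC tmin] := ex_minnP exP.
pose e := upd c i (c`_i + t.+1%:Z).
have ce : agree_off i c e by exact: upd_agree.
have ei : e`_i = c`_i + t.+1%:Z by exact: upd_at.
have emin (d : n.-1.-tuple int) : CC n d -> agree_off i c d -> c`_i < d`_i ->
    e`_i <= d`_i.
  move=> dC cd ltd.
  have dE : d`_i = c`_i + `|(d`_i - c`_i)%R|%N.-1.+1%:Z by lia.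
  suff : (t <= `|(d`_i - c`_i)%R|%N.-1)%N by rewrite ei; lia.
  by apply: tmin; apply/asboolP; rewrite -(@lineE d _ cd).
have [] : cc_covers c (up i c) /\
    forall j : 'I_n.-1, j != i -> tnth (up i c) j = tnth c j.
  apply: (@xgetI _ c [set c' | cc_covers c c' /\
            forall j : 'I_n.-1, j != i -> tnth c' j = tnth c j] e).
  split; last exact/agree_offP.
  have lte : c`_i < e`_i by rewrite ei; lia.
  split=> //; first exact: cc_lt_agree ce lte.
  move=> [d [dC [/cc_leP cd cNd] [/cc_leP de dNe]]].
  have cda : agree_off i c d.
    move=> k ki; apply/eqP; rewrite eq_le cd andbT.
    by rewrite -(ce k ki) de.
  case: (ltrP c`_i d`_i) => [ltd|led].
    apply: dNe; apply: eq_nth_tuple => k.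
    have [->|ki] := eqVneq k (i : nat); last by rewrite ce ?cda.
    by apply/le_anti; rewrite de emin.
  apply: cNd; apply: eq_nth_tuple => k.
  have [->|ki] := eqVneq k (i : nat); last by rewrite cda.
  by apply/le_anti; rewrite led cd.
move=> cov /agree_offP cu.
have ltu : c`_i < (up i c)`_i.
  case: cov => _ _ [/cc_leP le ne] _; rewrite lt_neqAle le andbT.
  apply/eqP => E; apply: ne; apply: eq_nth_tuple => k.
  by have [->//|/cu->] := eqVneq k (i : nat).
split=> // d dC cd ltd; case: cov => _ _ _ nobetween.
rewrite leNgt; apply/negP => ltdu; apply: nobetween.
exists d; split=> //; first exact: cc_lt_agree cd ltd.
apply: (cc_lt_agree (i := i)) => // k ki.
by rewrite cu ?cd.
Qed.

Lemma card_eq_full N (A : set 'I_N) : A #= `I_N -> A = [set: 'I_N].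
Proof.
rewrite (card_eqr card_II) card_eq_sym => /card_eqP[f].
pose g i := \val (f (to_setT i)).
have [|h _ gh] := @injF_bij _ g.
  move=> i j /val_inj /(@inj _ _ _ f _ _ (in_setT _) (in_setT _)).
  by move/(congr1 val).
by apply/seteqP; split=> // i _; rewrite -(gh i); exact: set_valP.
Qed.

(** The covers of c are the distinct elements [up i c] for i raisable, so there
are n-1 of them iff each of the n-1 indices is raisable. *)
Lemma output_wingP n (c : n.-1.-tuple int) : (0 < n)%N ->
  output_wing c <-> CC n c /\ forall i, raisable c i.
Proof.
move=> n_gt0.
suff E : CC n c ->
    ([set d | cc_covers c d] #= `I_n.-1 <-> forall i, raisable c i).
  by split=> -[cC]; move/(E cC).
move=> cC.
have imE :
    [set d | cc_covers c d] = (fun i => up i c) @` [set i | raisable c i].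
  apply/seteqP; split=> d /=; last first.
    by move=> [i ri <-]; case: (up_raisable cC ri).
  move=> [_ dC cd nob].
  have [i [e [eC ce lte ed]]] := cc_le_step n_gt0 cC dC cd.
  have {ed} eE : e = d.
    apply: contrapT => ne; apply: nob; exists e; split=> //.
    exact: cc_lt_agree ce lte.
  subst e; have ri : raisable c i by exists d.
  exists i => //; have [[_ uC ltu _] cu lti mini] := up_raisable cC ri.
  apply: contrapT => ne; apply: nob; exists (up i c); split=> //.
  split=> //; apply: (agree_off_le (i := i)); last exact: mini.
  by move=> k ki; rewrite ce ?cu.
have injup : {in [set i | raisable c i] &, injective (fun i => up i c)}.
  move=> i j; rewrite !inE => ri rj E; apply/eqP; apply: contraPT E => /eqP ij.
  have [_ ci lti _] := up_raisable cC ri.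
  have [_ cj ltj _] := up_raisable cC rj.
  move=> E; move: lti; rewrite E cj ?ltxx //.
  exact/eqP/(contra_not _ ij)/val_inj.
rewrite imE (card_eql (inj_card_eq injup)); split=> [/card_eq_full E i|E].
  by have : [set: 'I_n.-1] i by []; rewrite -E.
rewrite (card_eqr card_II).
suff -> : [set i | raisable c i] = [set: 'I_n.-1] by exact: card_eqxx.
by apply/seteqP; split=> // i _; exact: E.
Qed.

Lemma raisable_neg n (c : n.-1.-tuple int) (i : 'I_n.-1) : (0 < n)%N ->
  CC n c -> c`_i < 0 -> raisable c i /\ (up i c)`_i <= 0.
Proof.
move=> n_gt0 cC ci0; have cc := (CC_cubic _ n_gt0).1 cC.
have eN : agree_off i c (upd c i 0) by exact: upd_agree.
have ei : (upd c i 0)`_i = 0 by exact: upd_at.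
have ltin : (i.+1 < n)%N by have := ltn_ord i; lia.
have eC : CC n (upd c i 0).
  apply/(CC_cubic _ n_gt0).
  by apply: (shrink_back cc ltin eN); rewrite ?ei // /back ei; lia.
have ri : raisable c i by exists (upd c i 0); rewrite ei.
split=> //; have [_ _ _ /(_ _ eC eN)] := up_raisable cC ri.
by rewrite ei; apply.
Qed.

(** The criterion for lengthening the right arm of i over the next position m
and everything that m reaches. *)
Definition jumpable n (c : seq int) (i : nat) : Prop :=
  let m := (reach c i).+1 in
  [/\ (m < n)%N, (i + back c m < m)%N &
      forall k, (k < i)%N -> (i <= reach c k)%N -> reach c k <> reach c i].

(** A longer right arm of i contains m, hence by nesting the whole right arm of
m, and the conditions of [jumpable] are those imposed by m alone. *)
Lemma raise_jumpable n (c d : seq int) i :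
  cubic n c -> cubic n d -> (i < n)%N -> agree_off i c d ->
  0 <= c`_i -> c`_i < d`_i ->
  jumpable n c i /\ (reach c (reach c i).+1 <= reach d i)%N.
Proof.
move=> cc dd lti cd ci0 ltd.
have rlt : (reach c i < reach d i)%N by rewrite /reach; lia.
have rE k : k != i -> reach d k = reach c k by exact: reach_agree cd.
have rdlt := reach_lt dd lti.
have gei := reach_ge c i.
have mi : (reach c i).+1 != i by lia.
split; last first.
  by rewrite -(rE _ mi); apply: (reach_closed dd) => //; lia.
split; first by lia.
- have <- : back d (reach c i).+1 = back c (reach c i).+1.
    have [jE|/(back_agree cd)//] := eqVneq (reach c i).+1 i.+1.
    by rewrite jE /back; lia.
  by apply: (reach_back dd) => //; lia.
- move=> k ki ik E; have := reach_closed dd (ltnW ki).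
  by rewrite (rE k) => [/(_ ik)|]; lia.
Qed.

(** The conditions at m suffice: the positions beyond m that are newly reached
from i are already reached from m, so compatibility in c keeps their left arms
to the right of m. *)
Lemma jumpable_raisable n (c : n.-1.-tuple int) (i : 'I_n.-1) : (0 < n)%N ->
  CC n c -> 0 <= c`_i -> jumpable n c i ->
  raisable c i /\ reach (up i c) i = reach c (reach c i).+1.
Proof.
move=> n_gt0 cC ci0 [mlt bm outer]; have cc := (CC_cubic _ n_gt0).1 cC.
set m := (reach c i).+1 in mlt bm *.
have mE : m = (reach c i).+1 by [].
have gei := reach_ge c i.
have gem := reach_ge c m.
have lti : (i < n)%N by have := ltn_ord i; lia.
have mltn := reach_lt cc mlt.
pose e := upd c i (reach c m - i)%N.
have eN : agree_off i c e by exact: upd_agree.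
have ei : e`_i = (reach c m - i)%N by exact: upd_at.
have re : reach e i = reach c m by rewrite {1}/reach ei; lia.
have lte : c`_i < e`_i.
  rewrite ei.
  have : reach c i = (i + `|(c`_i)%R|)%N by rewrite /reach; lia.
  by move: (reach c m) (reach c i) mE gem gei => rm ri; lia.
have eC : CC n e.
  apply/(CC_cubic _ n_gt0).
  apply: (extend_reach cc lti eN) => //; rewrite re //.
  - move=> k ik ki; have [km|mk] := ltnP k m; last exact: (reach_closed cc).
    by apply: leq_trans gem; apply: leqW; apply: (reach_closed cc) => //; lia.
  - move=> k ki ik; apply: (reach_closed cc) => //; try lia.
    have := reach_closed cc (ltnW ki) ik; have := outer k ki ik; lia.
  - move=> j ij jm; have [jm'|mj] := ltnP j m.
      by apply: (reach_back cc) => //; lia.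
    have [->//|jNm] := eqVneq j m.
    by have := reach_back cc (_ : (m < j)%N) _ jm; lia.
have ri : raisable c i by exists e.
split=> //; have [[_ uC _ _] cu ltu mini] := up_raisable cC ri.
have uu := (CC_cubic _ n_gt0).1 uC.
have [_ le] := raise_jumpable cc uu lti cu ci0 ltu.
by apply/eqP; rewrite eqn_leq le andbT -re reach_le ?mini.
Qed.

Lemma output_wing_jumpable n (c : n.-1.-tuple int) (i : 'I_n.-1) :
  (0 < n)%N -> output_wing c -> 0 <= c`_i -> jumpable n c i.
Proof.
move=> n_gt0 /(output_wingP _ n_gt0)[cC /(_ i)[d [dC cd ltd]]] ci0.
have lti : (i < n)%N by have := ltn_ord i; lia.
have cc := (CC_cubic _ n_gt0).1 cC; have dd := (CC_cubic _ n_gt0).1 dC.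
by have [] := raise_jumpable cc dd lti cd ci0 ltd.
Qed.

(** * The input-wing *)

(** The state d reached from the output-wing c once the indices k, k+1, ...
have been raised, in decreasing order. In the last clause the right end of the
position m after the right end of i is the one in d: m > i has been raised
before i, and the later moves do not affect it. *)
Record raised_from (n : nat) (k : nat) (c d : seq int) : Prop := RaisedFrom {
  raised_below : forall i, (i < k)%N -> d`_i = c`_i;
  raised_neg : forall i, (k <= i < n.-1)%N -> c`_i < 0 -> c`_i < d`_i <= 0;
  raised_ge0 : forall i, (k <= i < n.-1)%N -> 0 <= c`_i ->
    reach d i = reach d (reach c i).+1 }.

Lemma raised_from_ge n k (c d : n.-1.-tuple int) :
  raised_from n k c d -> forall i, c`_i <= d`_i.
Proof.
move=> [below neg ge0] i; have [/below->//|ki] := ltnP i k.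
have [lti|lei] := ltnP i n.-1; last by rewrite !nth_default ?size_tuple.
have kin : (k <= i < n.-1)%N by rewrite ki.
case: (ltrP c`_i 0) => [/neg|/ge0] /(_ kin); first by case/andP => /ltW.
by move=> rE; apply/ltW/lt_reach; rewrite rE reach_ge.
Qed.

(** All moves remain available along the way: the conditions for raising i bear
on the right arms of index at most i, which are still those of c, and on a left
arm, which can only have become shorter. *)
Lemma input_wing_raised n (c : n.-1.-tuple int) : (0 < n)%N -> output_wing c ->
  CC n (input_wing c) /\ raised_from n 0 c (input_wing c).
Proof.
move=> n_gt0 cW.
pose st k := foldr (@up n) c (drop k (enum 'I_n.-1)).
have -> : input_wing c = st 0%N by rewrite /st drop0.
have [cC _] := (output_wingP c n_gt0).1 cW.
suff /(_ n.-1 0%N) : forall t k, (k + t)%N = n.-1 ->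
    CC n (st k) /\ raised_from n k c (st k) by apply.
elim=> [|t IHt] k kt.
  rewrite /st drop_oversize ?size_enum_ord; last lia.
  by split=> //; split=> // i /andP[ki ltin]; move: kt; rewrite addn0; lia.
have ltk : (k < n.-1)%N by lia.
have [|dC dR] := IHt k.+1; first lia.
pose i := Ordinal ltk.
have stE : st k = up i (st k.+1).
  rewrite /st (drop_nth i) ?size_enum_ord //=; congr up.
  by apply: val_inj; rewrite /= nth_enum_ord.
move: dC dR; rewrite {}stE; move: (st k.+1) => d dC dR.
have below := raised_below dR.
have di : d`_i = c`_i by rewrite below.
have reachE j : (j <= k)%N -> reach d j = reach c j.
  by move=> jk; rewrite /reach below.
have [ri up_neg up_ge0] : [/\ raisable d i,
    c`_i < 0 -> (up i d)`_i <= 0 &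
    0 <= c`_i -> reach (up i d) i = reach d (reach c i).+1].
  case: (ltrP c`_i 0) => ci0.
    have [|ri le] := @raisable_neg _ d i n_gt0 dC; first by rewrite di.
    by split=> //; lia.
  have [lt1 lt2 outer] := output_wing_jumpable n_gt0 cW ci0.
  have [| |ri rE] := @jumpable_raisable _ d i n_gt0 dC; first by rewrite di.
    split; rewrite (reachE i) //.
      by have := back_ge (reach c i).+1 (raised_from_ge dR); lia.
    by move=> j ji; rewrite reachE; [exact: outer|exact: ltnW].
  by split=> // _; rewrite rE (reachE i).
have [[_ uC _ _] du ltu _] := up_raisable dC ri.
split=> //; split.
- by move=> j jk; rewrite du ?below //=; lia.
- move=> j /andP[kj ltj]; have [->|jk] := eqVneq j k.
    by move=> ck0; rewrite -di ltu up_neg.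
  by rewrite du //; apply: (raised_neg dR); lia.
- move=> j /andP[kj ltj] cj0.
  have rE l : l != k -> reach (up i d) l = reach d l by exact: reach_agree du.
  rewrite [RHS]rE; last by have := reach_ge c j; lia.
  move: cj0; have [->|jk] := eqVneq j k; first exact: up_ge0.
  by rewrite rE //; apply: (raised_ge0 dR); lia.
Qed.

Lemma raised_gt n (c d : n.-1.-tuple int) i :
  raised_from n 0 c d -> (i < n.-1)%N -> c`_i < d`_i.
Proof.
move=> dR lti; case: (ltrP c`_i 0) => ci0.
  by case/andP: (raised_neg dR lti ci0).
by apply: lt_reach; rewrite (raised_ge0 dR) ?reach_ge.
Qed.

(** * The map Gamma on output-wings *)

(** Right ends in an output-wing c and its input-wing d, the last position n-1,
which carries no component, being treated together with the negative
components. *)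
Variant reach_spec n (c d : seq int) (i : nat) : nat -> nat -> Prop :=
| ReachStay of (n.-1 <= i)%N \/ c`_i < 0 : reach_spec n c d i i i
| ReachJump of (i < n.-1)%N & 0 <= c`_i :
    reach_spec n c d i (reach c i) (reach d (reach c i).+1).

Lemma reachP n (c d : n.-1.-tuple int) i :
  raised_from n 0 c d -> reach_spec n c d i (reach c i) (reach d i).
Proof.
move=> dR; have [lti|lei] := ltnP i n.-1; last first.
  by rewrite /reach !nth_default ?size_tuple // addn0; constructor; left.
case: (ltrP c`_i 0) => ci0.
  have di := raised_neg dR lti ci0.
  have -> : reach c i = i by rewrite /reach; lia.
  have -> : reach d i = i by rewrite /reach; lia.
  by constructor; right.
by rewrite (raised_ge0 dR) //; constructor.
Qed.

(** The jumps that lead from k to its right end in d pass from right end to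
right end of arms of c nested in that of i, none of which ends where that of i
does; so they never jump past the end of i. *)
Lemma reach_raised_inner n (c d : n.-1.-tuple int) i k : (0 < n)%N ->
  output_wing c -> raised_from n 0 c d -> (i < n)%N ->
  (i < k)%N -> (k <= reach c i)%N -> (reach d k <= reach c i)%N.
Proof.
move=> n_gt0 cW dR lti.
have cc : cubic n c by apply/(CC_cubic _ n_gt0); case: cW.
have [t] := ubnP (n - k); elim: t k => // t IHt k kt ik ki.
have ltk := leq_ltn_trans ki (reach_lt cc lti).
have := reach_closed cc (ltnW ik) ki lti.
have : (k < n.-1)%N -> 0 <= c`_k -> reach c i <> reach c k.
  move=> ltk' ck0.
  have [_ _ /(_ i ik ki)//] :=
    @output_wing_jumpable n c (Ordinal ltk') n_gt0 cW ck0.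
have := reach_ge c k.
case: (reachP k dR) => // ltk' ck0 gek /(_ ltk' ck0) ne le.
by apply: IHt; lia.
Qed.

(** The value of Gamma on the cell from c to d. *)
Definition fill n (c d : n.-1.-tuple int) : n.-1.-tuple int :=
  [tuple if tnth c i < 0 then tnth c i else tnth d i | i < n.-1].

Lemma nth_fill n (c d : n.-1.-tuple int) i :
  (fill c d)`_i = if c`_i < 0 then c`_i else d`_i.
Proof.
have [lti|lei] := ltnP i n.-1; last first.
  by rewrite !nth_default ?size_tuple.
by rewrite -!(tnth_nth 0 _ (Ordinal lti)) tnth_mktuple.
Qed.

Lemma reach_fill n (c d : n.-1.-tuple int) i :
  raised_from n 0 c d -> reach (fill c d) i = reach d i.
Proof.
move=> dR; rewrite /(reach (fill c d) i) nth_fill; case: ifP => // ci0.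
case: (reachP i dR) => [_|_]; last by rewrite leNgt ci0.
by lia.
Qed.

Lemma back_fill n (c d : n.-1.-tuple int) j :
  raised_from n 0 c d -> back (fill c d) j = back c j.
Proof.
move=> dR; case: j => // j; rewrite /back nth_fill.
by have := raised_from_ge dR j; case: ifP; lia.
Qed.

(** Only the compatibility of the right arms of d with the left arms of c is at
stake. It is proved along the jumps: a position j reached from i in d lies in
the arm of i in c, or is m, or is reached from m in d. *)
Lemma fill_CC n (c d : n.-1.-tuple int) : (0 < n)%N ->
  output_wing c -> CC n d -> raised_from n 0 c d -> CC n (fill c d).
Proof.
move=> n_gt0 cW /(CC_cubic _ n_gt0) dd dR.
have cc : cubic n c by apply/(CC_cubic _ n_gt0); case: cW.
apply/(CC_cubic _ n_gt0); split.
- by move=> i; rewrite reach_fill //; exact: reach_lt.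
- by move=> i k; rewrite !reach_fill //; exact: reach_closed.
- by move=> j; rewrite back_fill //; exact: back_le.
- by move=> j k; rewrite !back_fill //; exact: back_closed.
move=> i j; rewrite reach_fill // back_fill //.
have [t] := ubnP (n - i); elim: t i => // t IHt i it ij ltj.
have := @reach_back _ _ cc i j ij ltj.
have := @output_wing_jumpable n c _ n_gt0 cW.
have := reach_ge c i.
case: (reachP i dR) => [_|lti ci0]; first lia.
move=> gei /(_ (Ordinal lti) ci0)[/= mlt bm _] before ji.
have [jm|mj] := ltnP j (reach c i).+1; first exact: before.
have [->//|jNm] := eqVneq j (reach c i).+1.
have := IHt (reach c i).+1; lia.
Qed.

(** The right ends in d, d' agree, and [reach_raised_inner] says that r i + 1
is the first position after i whose right end in d is at least that of i; so
neither of the right ends of i in c and c' can be the smaller. *)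
Lemma fill_inj n (c c' d d' : n.-1.-tuple int) : (0 < n)%N ->
  output_wing c -> output_wing c' ->
  raised_from n 0 c d -> raised_from n 0 c' d' ->
  fill c d = fill c' d' -> c = c'.
Proof.
move=> n_gt0 cW cW' dR dR' E.
have rdE i : reach d i = reach d' i.
  by rewrite -(reach_fill i dR) -(reach_fill i dR') E.
have noless (a a' b b' : n.-1.-tuple int) i : output_wing a' ->
    raised_from n 0 a b -> raised_from n 0 a' b' ->
    (forall k, reach b k = reach b' k) -> (i < n.-1)%N ->
    0 <= a`_i -> 0 <= a'`_i -> (reach a' i <= reach a i)%N.
  move=> aW' bR bR' bE lti ai ai'; rewrite leqNgt; apply/negP => lt.
  have gei := reach_ge a i; have ltin : (i < n)%N by lia.
  have := @reach_raised_inner _ _ _ _ (reach a i).+1 n_gt0 aW' bR' ltin _ lt.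
  rewrite -bE -(raised_ge0 bR) // bE (raised_ge0 bR') //.
  by have := reach_ge b' (reach a' i).+1; lia.
apply: eq_nth_tuple => i; have [lti|lei] := ltnP i n.-1; last first.
  by rewrite !nth_default ?size_tuple.
have := congr1 (fun s : n.-1.-tuple int => s`_i) E; rewrite /= !nth_fill.
have gt := raised_gt dR lti; have gt' := raised_gt dR' lti.
case: (ltrP c`_i 0) => ci0; case: (ltrP c'`_i 0) => ci0' //; [lia..|move=> _].
have le := noless _ _ _ _ _ cW' dR dR' rdE lti ci0 ci0'.
have le' := noless _ _ _ _ _ cW dR' dR (fun k => esym (rdE k)) lti ci0' ci0.
suff : c`_i <= c'`_i <= c`_i by move/le_anti.
by move: le le'; rewrite /reach; lia.
Qed.

(** * The inverse construction *)

(** If s_i > 0, the position i + 1 + gap is the first one after i whose right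
end is at least that of i, that is, the start of the last of the maximal right
arms that decompose the arm of i without i itself. *)
Definition gap (s : seq int) (n i : nat) : nat :=
  find (fun k => reach s i <= reach s k)%N (iota i.+1 n).

Lemma gapP n (s : seq int) i : cubic n s -> (i < n.-1)%N -> 0 < s`_i ->
  [/\ (i + gap s n i < reach s i)%N,
      (reach s i <= reach s (i + gap s n i).+1)%N &
      forall k, (i < k)%N -> (k <= i + gap s n i)%N ->
        (reach s k < reach s i)%N].
Proof.
move=> ss lti si0.
have ltin : (i < n)%N by lia.
have rlt := reach_lt ss ltin.
have ri : (i < reach s i)%N by rewrite /reach; lia.
have before k : (i < k)%N -> (k <= i + gap s n i)%N -> (k < i.+1 + n)%N ->
    (reach s k < reach s i)%N.
  move=> ik ki kn; have lt : (k - i.+1 < gap s n i)%N by lia.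
  have := before_find 0%N lt; rewrite nth_iota; last lia.
  by rewrite subnKC // ltnNge => ->.
have rgap : (i + gap s n i < reach s i)%N.
  rewrite ltnNge; apply/negP => /(before _ ri); have := reach_ge s (reach s i).
  by lia.
split=> //; last by move=> k ik ki; apply: before => //; lia.
have hasP : has (fun k => reach s i <= reach s k)%N (iota i.+1 n).
  by rewrite has_find size_iota -/(gap s n i); lia.
have := nth_find 0%N hasP; rewrite -/(gap s n i) nth_iota ?addSn //; lia.
Qed.

(** Keeping the left arms of s, each right arm of positive length is cut just
before the position given by [gap]. *)
Definition hollow n (s : n.-1.-tuple int) : n.-1.-tuple int :=
  [tuple if tnth s i < 0 then tnth s i else (gap s n i)%:Z | i < n.-1].

Lemma nth_hollow n (s : n.-1.-tuple int) i : (i < n.-1)%N ->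
  (hollow s)`_i = if s`_i < 0 then s`_i else gap s n i.
Proof.
by move=> lti; rewrite -!(tnth_nth 0 _ (Ordinal lti)) tnth_mktuple.
Qed.

Lemma back_hollow n (s : n.-1.-tuple int) j : back (hollow s) j = back s j.
Proof.
case: j => // j; rewrite /back; have [ltj|lej] := ltnP j n.-1.
  by rewrite nth_hollow //; case: ifP; lia.
by rewrite !nth_default ?size_tuple.
Qed.

Section Hollow.
Variables (n : nat) (s : n.-1.-tuple int).
Hypotheses (n_gt0 : (0 < n)%N) (ss : cubic n s).
Hypothesis s_neq0 : forall i, (i < n.-1)%N -> s`_i != 0.

Lemma reach_hollowP i :
  reach (hollow s) i = i /\ reach s i = i \/
  [/\ (i < n.-1)%N, 0 < s`_i & reach (hollow s) i = (i + gap s n i)%N].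
Proof.
have [lti|lei] := ltnP i n.-1; last first.
  by left; rewrite /reach !nth_default ?size_tuple // addn0.
rewrite /reach nth_hollow //; have := s_neq0 lti.
by case: ltrgt0P => // si0 _; [right; split=> //|left]; lia.
Qed.

Lemma reach_hollow_le i : (reach (hollow s) i <= reach s i)%N.
Proof.
case: (reach_hollowP i) => [[-> ->]//|[lti si0 ->]].
by have [/ltnW] := gapP ss lti si0.
Qed.

(** If the arm of k in s left the shortened arm of i, it would contain the
position m just after it, hence reach as far as m and as i, against the choice
of m. *)
Lemma reach_hollow_inner i k : (i < k)%N -> (k <= reach (hollow s) i)%N ->
  (reach s k <= reach (hollow s) i)%N.
Proof.
move=> ik; case: (reach_hollowP i) => [[-> _]|[lti si0 ->]] ki; first lia.
have [rlt rge inner] := gapP ss lti si0.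
have ltn_i : (i < n)%N by lia.
have ltk : (k < n)%N by have := reach_lt ss ltn_i; lia.
have /negP ler : ~~ (reach s i <= reach s k)%N by rewrite -ltnNge inner.
rewrite leqNgt; apply/negP => mk.
apply: ler; apply: leq_trans rge _.
by apply: (reach_closed ss) => //; rewrite ltnW.
Qed.

Lemma hollow_CC : CC n (hollow s).
Proof.
apply/(CC_cubic _ n_gt0); split.
- by move=> i lti; apply: leq_ltn_trans (reach_hollow_le i) (reach_lt ss lti).
- move=> i k; rewrite leq_eqVlt => /predU1P[->//|ik] ki _.
  exact: leq_trans (reach_hollow_le k) (reach_hollow_inner ik ki).
- by move=> j; rewrite back_hollow; exact: back_le.
- by move=> j k; rewrite !back_hollow; exact: back_closed.
- move=> i j ij ltj ji; rewrite back_hollow; apply: (reach_back ss) => //.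
  exact: leq_trans ji (reach_hollow_le i).
Qed.

Lemma hollow_jumpable i : (i < n.-1)%N -> 0 <= (hollow s)`_i ->
  jumpable n (hollow s) i.
Proof.
move=> lti; rewrite nth_hollow //; have := s_neq0 lti.
case: ltrgt0P => // si0 _; [move=> _|by rewrite leNgt si0].
have [rlt rge inner] := gapP ss lti si0.
have ltin : (i < n)%N by lia.
have rE : reach (hollow s) i = (i + gap s n i)%N.
  by rewrite {1}/reach nth_hollow //; case: ltrP; lia.
have rsn := reach_lt ss ltin.
split; rewrite rE; first lia.
  by rewrite back_hollow; apply: (reach_back ss); lia.
by move=> k ki ik E; have := reach_hollow_inner ki ik; lia.
Qed.

Lemma hollow_output_wing : output_wing (hollow s).
Proof.
apply/(output_wingP _ n_gt0); split=> [|i]; first exact: hollow_CC.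
case: (ltrP (hollow s)`_i 0) => hi0.
  by case: (raisable_neg n_gt0 hollow_CC hi0).
have ji := hollow_jumpable (ltn_ord i) hi0.
by case: (jumpable_raisable n_gt0 hollow_CC hi0 ji).
Qed.

(** The recursion that determines the right ends in the input-wing is solved by
the right ends in s: by the choice of m, the positions i and m have the same
one. *)
Lemma fill_hollow (d : n.-1.-tuple int) :
  CC n d -> raised_from n 0 (hollow s) d -> fill (hollow s) d = s.
Proof.
move=> /(CC_cubic _ n_gt0) dd dR.
have hollow_pos i : (i < n.-1)%N -> 0 <= (hollow s)`_i -> 0 < s`_i.
  move=> lti; rewrite nth_hollow //; have := s_neq0 lti.
  by case: ltrgt0P => // si0 _; rewrite leNgt si0.
have rE i : (i < n)%N -> reach d i = reach s i.
  have [t] := ubnP (n - i); elim: t i => // t IHt i it ltin.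
  case: (reachP i dR) => [stay|lti hi0].
    case: (reach_hollowP i) => [[_ ->]//|[lti si0 _]].
    by case: stay; [lia|rewrite nth_hollow // (lt_gtF si0)].
  have si0 := hollow_pos i lti hi0.
  have -> : reach (hollow s) i = (i + gap s n i)%N.
    by rewrite /reach nth_hollow //; case: ltrP; lia.
  have [rlt rge inner] := gapP ss lti si0.
  have rsn := reach_lt ss ltin.
  rewrite IHt; [|lia..].
  by apply/eqP; rewrite eqn_leq rge andbT; apply: (reach_closed ss) => //; lia.
apply: eq_nth_tuple => i; have [lti|lei] := ltnP i n.-1; last first.
  by rewrite !nth_default ?size_tuple.
rewrite nth_fill; case: (ltrP (hollow s)`_i 0) => [|hi0].
  by rewrite nth_hollow //; case: (ltrP s`_i 0) => //; lia.
have si0 := hollow_pos i lti hi0.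
suff : s`_i <= d`_i <= s`_i by move/le_anti.
have ltin : (i < n)%N by lia.
by have := rE i ltin; rewrite /reach; lia.
Qed.

End Hollow.

(** * The bijection *)

Lemma Gamma_wing (R : realType) n (c : n.-1.-tuple int) : (0 < n)%N ->
  output_wing c ->
  corners (cell R c (input_wing c)) = (c, input_wing c) /\
  Gamma (cell R c (input_wing c)) = fill c (input_wing c).
Proof.
move=> n_gt0 cW; have [dC dR] := input_wing_raised n_gt0 cW.
suff E : corners (cell R c (input_wing c)) = (c, input_wing c).
  by split=> //; rewrite /Gamma E.
apply: corners_cell => //; first by case: cW.
exact/cc_leP/(raised_from_ge dR).
Qed.

Theorem theorem3p3p4 (R : realType) (n : nat) (hn : (1 <= n)%N) :
  set_bij [set X : set 'rV[R]_n.-1 | cell_wing X /\ cell_dim X = n.-1]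
          (SCC n) (@Gamma R n).
Proof.
split.
- move=> _ [[c cW ->] _]; have [dC dR] := input_wing_raised hn cW.
  rewrite (Gamma_wing R hn cW).2; split; first exact: fill_CC.
  move=> i; rewrite (tnth_nth 0) nth_fill.
  have := raised_gt dR (ltn_ord i).
  case: (ltrP c`_i 0) => [ci0 _|ci0 lt]; first by rewrite lt_eqF.
  by rewrite gt_eqF ?(le_lt_trans ci0).
- move=> _ _ /set_mem[[c cW ->] _] /set_mem[[c' cW' ->] _].
  rewrite (Gamma_wing R hn cW).2 (Gamma_wing R hn cW').2 => E.
  have [_ dR] := input_wing_raised hn cW.
  have [_ dR'] := input_wing_raised hn cW'.
  by rewrite (fill_inj hn cW cW' dR dR' E).
- move=> s [/(CC_cubic _ hn) ss s0].
  have s_neq0 i : (i < n.-1)%N -> s`_i != 0.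
    by move=> lti; rewrite -(tnth_nth 0 _ (Ordinal lti)).
  have cW := hollow_output_wing hn ss s_neq0.
  have [dC dR] := input_wing_raised hn cW.
  exists (cell R (hollow s) (input_wing (hollow s))).
    split; first by exists (hollow s).
    rewrite /cell_dim (Gamma_wing R hn cW).1 /= -[RHS]card_ord.
    apply: eq_card => i; rewrite !inE !(tnth_nth 0).
    by rewrite lt_eqF // (raised_gt dR).
  by rewrite (Gamma_wing R hn cW).2 (fill_hollow hn ss s_neq0 dC dR).
Qed.
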